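(* Suppose that quasi-Banach spaces $X$, $Y$, $Z$ and a bounded linear operator $T:X\to Z$ satisfy the following two conditions: the continuous embedding $Y\hookrightarrow Z$ holds true, and there exist bounded linear operators $R:Z\to X$ and $S:Z\to Y$ such that $TRw=w+Sw$ for every $w\in Z$. Then: (i) If $X$ and $Y$ are separable, then $X(T,Y)$ is also separable. (ii) If a certain set $M\subset X(T,Y)$ is dense in $X(T,Y)$ in the quasi-norm $\|\cdot\|_{X}$ and $T(M)$ is dense in $Y\cap T(X)$ in the quasi-norm $\|\cdot\|_{Y}$ and, moreover, $R(T(M))\subset M$, then $M$ is dense in the quasi-normed space $X(T,Y)$.
   Context: All linear spaces are complex. $Y\hookrightarrow Z$ means that $Y$ is a linear manifold (a linear subspace, not necessarily closed) in $Z$ and that the identity mapping is a continuous operator from $Y$ to $Z$. The space $X(T,Y):=\{u\in X: Tu\in Y\}$ is endowed with the graph quasi-norm $\|u\|_{X(T,Y)}:=\|u\|_{X}+\|Tu\|_{Y}$.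
   Formalization: In (ii) the set M is additionally assumed closed under subtraction (as every linear subspace is); for a completely arbitrary set M the claim (ii) is false. *)

(* Defs.v *)
From HB Require Import structures.
From mathcomp Require Import all_boot all_order all_algebra.
From mathcomp Require Import complex.
From mathcomp Require Import all_classical all_reals all_analysis.

Set Implicit Arguments.
Unset Strict Implicit.
Unset Printing Implicit Defensive.

Import Order.TTheory GRing.Theory Num.Theory.
Import numFieldNormedType.Exports.

Local Open Scope classical_set_scope.
Local Open Scope ring_scope.

(* A quasi-normed space is represented by an ambient complex vector space V,
   a linear manifold A in V and a function q : V -> F, of which only the values
   on A matter.  A linear manifold of V may thus carry a quasi-norm unrelated to
   a quasi-norm on V; a space not given inside another one has A = [set: V]. *)

Section QuasiNormedSpace.
Variables (F : realType) (V : lmodType F[i]).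
Implicit Types (A B D M : set V) (q : V -> F).

Definition linear_manifold A : Prop := submod_closed [in A].

Record quasi_norm A q : Prop := QuasiNorm {
  quasi_norm_ge0 : forall x, A x -> 0 <= q x ;
  quasi_norm_eq0 : forall x, A x -> q x = 0 -> x = 0 ;
  quasi_normZ : forall (a : F[i]) x, A x -> q (a *: x) = Normc.normc a * q x ;
  quasi_normD : exists2 C : F, 1 <= C &
    forall x y, A x -> A y -> q (x + y) <= C * (q x + q y) }.

Definition quasi_cauchy q (u : nat -> V) : Prop :=
  forall e : F, 0 < e -> exists N : nat, forall m n : nat,
    (N <= m)%N -> (N <= n)%N -> q (u m - u n) < e.

Definition quasi_cvg q (u : nat -> V) (l : V) : Prop :=
  (fun n : nat => q (u n - l)) @ \oo --> (0 : F).

Record quasi_banach A q : Prop := QuasiBanach {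
  quasi_banach_linear : linear_manifold A ;
  quasi_banach_norm : quasi_norm A q ;
  quasi_banach_complete : forall u : nat -> V, (forall n, A (u n)) ->
    quasi_cauchy q u -> exists2 l, A l & quasi_cvg q u l }.

(* A need not be a linear manifold here: q may be defined on a larger one. *)
Definition dense_in A q M : Prop :=
  M `<=` A /\
  forall x, A x -> forall e : F, 0 < e -> exists2 m, M m & q (x - m) < e.

Definition separable_space A q : Prop :=
  exists2 D, countable D & dense_in A q D.

End QuasiNormedSpace.

Section Operators.
Variables (F : realType) (V W : lmodType F[i]).
Variables (A : set V) (qA : V -> F) (B : set W) (qB : W -> F).

Definition bounded_operator (f : V -> W) : Prop :=
  (forall x, A x -> B (f x)) /\
  exists C : F, forall x, A x -> qB (f x) <= C * qA x.

Definition continuous_operator (f : V -> W) : Prop :=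
  (forall x, A x -> B (f x)) /\
  forall x, A x -> forall e : F, 0 < e -> exists2 d : F, 0 < d &
    forall y, A y -> qA (y - x) < d -> qB (f y - f x) < e.

End Operators.

Definition continuous_embedding (F : realType) (V : lmodType F[i])
    (A : set V) (qA : V -> F) (B : set V) (qB : V -> F) : Prop :=
  [/\ linear_manifold A, A `<=` B & continuous_operator A qA B qB id].

Section GraphSpace.
Variables (F : realType) (X Z : lmodType F[i]).

Definition graph_space (T : X -> Z) (Y : set Z) : set X := T @^-1` Y.

Definition graph_norm (qX : X -> F) (T : X -> Z) (qY : Z -> F) (u : X) : F :=
  qX u + qY (T u).

End GraphSpace.

(* Main.v *)
(* With P = I - RT one has TP = - ST, so P is bounded from X to X(T,Y), and R is
   bounded from Y to X(T,Y) since TR = I + S there.  Thus (x, y) |-> P x + R y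
   is bounded from X * Y to X(T,Y), and u = P u + R (T u) exhibits every u
   in X(T,Y) as its value at (u, T u): approximating u in X and T u in Y
   separately approximates u in the graph quasi-norm. *)
Require Import Defs.
From HB Require Import structures.
From mathcomp Require Import all_boot all_order all_algebra.
From mathcomp Require Import complex.
From mathcomp Require Import all_classical all_reals all_analysis.
From mathcomp Require Import ring lra.

Set Implicit Arguments.
Unset Strict Implicit.
Unset Printing Implicit Defensive.

Import Order.TTheory GRing.Theory Num.Theory.
Import numFieldNormedType.Exports.

Local Open Scope classical_set_scope.
Local Open Scope ring_scope.

(** * Linear manifolds and homogeneity of a quasi-norm *)

Section QuasiNorm.
Variables (F : realType) (V : lmodType F[i]) (A : set V) (q : V -> F).
Hypotheses (lin : linear_manifold A) (qn : quasi_norm A q).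

Lemma linear_manifold0 : A 0.
Proof. by case: lin => + _; rewrite inE. Qed.

Lemma linear_manifoldZD a x y : A x -> A y -> A (a *: x + y).
Proof. by case: lin => _ h Ax Ay; have := h a x y; rewrite !inE; apply. Qed.

Lemma linear_manifoldD x y : A x -> A y -> A (x + y).
Proof. by move=> Ax Ay; rewrite -[x]scale1r; exact: linear_manifoldZD. Qed.

Lemma linear_manifoldZ a x : A x -> A (a *: x).
Proof.
by move=> Ax; rewrite -[_ *: _]addr0; apply: linear_manifoldZD => //;
  exact: linear_manifold0.
Qed.

Lemma linear_manifoldN x : A x -> A (- x).
Proof. by rewrite -scaleN1r; exact: linear_manifoldZ. Qed.

Lemma linear_manifoldB x y : A x -> A y -> A (x - y).
Proof. by move=> Ax /linear_manifoldN; exact: linear_manifoldD. Qed.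

Lemma quasi_normZ_ge0 (t : F) x : 0 <= t -> A x -> q (t%:C%C *: x) = t * q x.
Proof.
move=> t0 Ax.
by rewrite (quasi_normZ qn)// /= expr0n addr0 sqrtr_sqr ger0_norm.
Qed.

Lemma quasi_norm0 : q 0 = 0.
Proof.
(* The zero vector is the real scalar 0 times itself, so real homogeneity applies. *)
rewrite -(scale0r (0 : V)) -[0 in LHS]/((0 : F)%:C%C) quasi_normZ_ge0 ?mul0r//.
exact: linear_manifold0.
Qed.

Lemma quasi_normN x : A x -> q (- x) = q x.
Proof.
move=> Ax; rewrite -scaleN1r (quasi_normZ qn)//=.
by rewrite oppr0 sqrrN expr1n expr0n addr0 sqrtr1 mul1r.
Qed.

End QuasiNorm.

(** * Bounded operators between quasi-normed spaces *)

Section BoundedOperator.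
Variables (F : realType) (U V : lmodType F[i]).
Variables (A : set U) (qA : U -> F) (B : set V) (qB : V -> F).
Hypotheses (qnA : quasi_norm A qA) (linB : linear_manifold B).
Hypothesis qnB : quasi_norm B qB.

(** The definition allows a constant of any sign; chaining estimates needs a positive one, and
    enlarging the constant is harmless because [qA] is nonnegative on [A]. *)
Lemma bounded_operator_gt0 (f : U -> V) : bounded_operator A qA B qB f ->
  exists2 C : F, 0 < C & forall x, A x -> qB (f x) <= C * qA x.
Proof.
move=> [_ [C fC]]; exists (`|C| + 1) => [|x Ax]; first by rewrite ltr_wpDl.
apply: (le_trans (fC x Ax)); apply: ler_wpM2r; first exact: quasi_norm_ge0 Ax.
by rewrite (le_trans (ler_norm C))// lerDl.
Qed.

Lemma bounded_operatorD (f g : U -> V) :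
  bounded_operator A qA B qB f -> bounded_operator A qA B qB g ->
  bounded_operator A qA B qB (fun x => f x + g x).
Proof.
move=> [fB [C fC]] [gB [C' gC]]; split=> [x Ax|].
  exact: linear_manifoldD (fB _ Ax) (gB _ Ax).
have [K K1 qK] := quasi_normD qnB; exists (K * (C + C')) => x Ax.
apply: (le_trans (qK _ _ (fB _ Ax) (gB _ Ax))).
rewrite -mulrA ler_wpM2l ?(le_trans ler01)// mulrDl.
by rewrite lerD ?fC ?gC.
Qed.

Lemma bounded_operatorN (f : U -> V) :
  bounded_operator A qA B qB f -> bounded_operator A qA B qB (fun x => - f x).
Proof.
move=> [fB [C fC]]; split=> [x Ax|]; first exact: linear_manifoldN (fB _ Ax).
by exists C => x Ax; rewrite (quasi_normN qnB) ?fC//; exact: fB.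
Qed.

End BoundedOperator.

Lemma bounded_operator_id (F : realType) (U : lmodType F[i]) (A : set U)
    (qA : U -> F) : bounded_operator A qA A qA id.
Proof. by split=> //; exists 1 => x _; rewrite mul1r. Qed.

Lemma bounded_operator_comp (F : realType) (U V W : lmodType F[i])
    (A : set U) (qA : U -> F) (B : set V) (qB : V -> F)
    (D : set W) (qD : W -> F) (g : V -> W) (f : U -> V) :
  quasi_norm B qB ->
  bounded_operator B qB D qD g -> bounded_operator A qA B qB f ->
  bounded_operator A qA D qD (g \o f).
Proof.
move=> qnB bg [fB [C fC]]; split=> [x Ax|]; first exact: bg.1 (fB _ Ax).
have [K K0 gK] := bounded_operator_gt0 qnB bg; exists (K * C) => x Ax /=.
by rewrite (le_trans (gK _ (fB _ Ax)))// -mulrA ler_pM2l// fC.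
Qed.

(** Continuity at 0 with tolerance 1 suffices: rescale a vector into the ball of radius [d] and undo
    the scaling by homogeneity. No triangle inequality enters. *)
Lemma continuous_embedding_bounded (F : realType) (V : lmodType F[i])
    (A : set V) (qA : V -> F) (B : set V) (qB : V -> F) :
  quasi_norm A qA -> linear_manifold B -> quasi_norm B qB ->
  continuous_embedding A qA B qB -> bounded_operator A qA B qB id.
Proof.
move=> qnA linB qnB [linA AB [_ cont]]; split; first exact: AB.
have [d d0 dP] := cont 0 (linear_manifold0 linA) 1 ltr01.
exists (2 / d) => x Ax; have := quasi_norm_ge0 qnA Ax.
(* A vector of quasi-norm 0 cannot be rescaled, but it is the zero vector. *)
rewrite le_eqVlt => /orP[/eqP/esym qx0|qx0].
  by rewrite (quasi_norm_eq0 qnA Ax qx0) (quasi_norm0 linB qnB)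
    (quasi_norm0 linA qnA) mulr0.
(* This [t] gives the rescaled vector quasi-norm [d / 2], strictly below [d]. Then [t * qB x < 1],
   and [t^-1] is exactly [2 / d * qA x]. *)
pose t := d / (2 * qA x); have t0 : 0 < t by rewrite divr_gt0// mulr_gt0.
have Atx : A (t%:C%C *: x) by exact: linear_manifoldZ.
have := dP _ Atx; rewrite !subr0 (quasi_normZ_ge0 qnA) ?(ltW t0)//.
have -> : t * qA x = d / 2 by rewrite /t; field; rewrite gt_eqF.
rewrite ltr_pdivrMr// ltr_pMr// ltr1n => /(_ isT).
rewrite (quasi_normZ_ge0 qnB) ?(ltW t0)//; last exact: AB.
rewrite -ltr_pdivlMl// mulr1 => /ltW; congr (_ <= _).
by rewrite /t; field; rewrite !gt_eqF.
Qed.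

(** * The graph quasi-norm *)

Section GraphSpaceTheory.
Variables (F : realType) (U X Z : lmodType F[i]) (A : set U) (qA : U -> F).
Variables (qX : X -> F) (Y : set Z) (qY : Z -> F) (T : {linear X -> Z}).

Lemma bounded_operator_graph (f : U -> X) :
  bounded_operator A qA [set: X] qX f -> bounded_operator A qA Y qY (T \o f) ->
  bounded_operator A qA (graph_space T Y) (graph_norm qX T qY) f.
Proof.
move=> [_ [C fC]] [fY [C' fC']]; split=> [|]; first exact: fY.
by exists (C + C') => x Ax; rewrite mulrDl lerD ?fC ?fC'.
Qed.

Lemma graph_normD : quasi_norm [set: X] qX -> quasi_norm Y qY ->
  exists2 C : F, 0 < C & forall u v, graph_space T Y u -> graph_space T Y v ->
    graph_norm qX T qY (u + v) <=
    C * (graph_norm qX T qY u + graph_norm qX T qY v).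
Proof.
move=> qnX qnY; have [C C1 qC] := quasi_normD qnX.
have [C' C'1 qC'] := quasi_normD qnY.
have C0 := lt_le_trans ltr01 C1; have C'0 := lt_le_trans ltr01 C'1.
(* The sum of the two constants dominates each of them, and all four quasi-norms involved are
   nonnegative. *)
exists (C + C') => [|u v Yu Yv]; first by rewrite addr_gt0.
rewrite /graph_norm linearD.
apply: (le_trans (lerD (qC u v I I) (qC' _ _ Yu Yv))).
have := quasi_norm_ge0 qnX (I : [set: X] u).
have := quasi_norm_ge0 qnX (I : [set: X] v).
have := quasi_norm_ge0 qnY Yu; have := quasi_norm_ge0 qnY Yv.
nra.
Qed.

End GraphSpaceTheory.

(** * Parametrizing the graph space by pairs from [X] and [Y] *)

Section Parametrization.
Variables (F : realType) (X Z : lmodType F[i]) (Y : set Z).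
Variables (qX : X -> F) (qY qZ : Z -> F).
Hypotheses (banachX : quasi_banach [set: X] qX) (banachY : quasi_banach Y qY).
Hypothesis banachZ : quasi_banach [set: Z] qZ.
Variable T : {linear X -> Z}.
Hypothesis T_bounded : bounded_operator [set: X] qX [set: Z] qZ T.
Hypothesis YZ : continuous_embedding Y qY [set: Z] qZ.
Variables (R : {linear Z -> X}) (S : {linear Z -> Z}).
Hypothesis R_bounded : bounded_operator [set: Z] qZ [set: X] qX R.
Hypothesis S_bounded : bounded_operator [set: Z] qZ Y qY S.
Hypothesis TR : forall w : Z, T (R w) = w + S w.

Let G := graph_space T Y.
Let qG := graph_norm qX T qY.
Let qnX := quasi_banach_norm banachX.
Let linX := quasi_banach_linear banachX.
Let qnY := quasi_banach_norm banachY.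
Let linY := quasi_banach_linear banachY.
Let qnZ := quasi_banach_norm banachZ.
Let idYZ :=
  continuous_embedding_bounded qnY (quasi_banach_linear banachZ) qnZ YZ.

Definition graph_param (x : X) (y : Z) : X := (x - R (T x)) + R y.

Lemma complement_bounded :
  bounded_operator [set: X] qX G qG (fun x => x - R (T x)).
Proof.
apply: bounded_operator_graph.
  apply: (bounded_operatorD linX qnX); first exact: bounded_operator_id.
  apply: (bounded_operatorN linX qnX).
  exact: (bounded_operator_comp qnZ R_bounded T_bounded).
(* The term [T x], which need not lie in [Y], cancels; what is left is in the range of [S], hence in
   [Y]. *)
have -> : T \o (fun x => x - R (T x)) = (fun x => - S (T x)).
  by apply/funext => x /=; rewrite linearB TR opprD addrA subrr sub0r.
apply: (bounded_operatorN linY qnY).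
exact: (bounded_operator_comp qnZ S_bounded T_bounded).
Qed.

Lemma lifting_bounded : bounded_operator Y qY G qG R.
Proof.
apply: bounded_operator_graph.
  (* The embedding of [Y] into [Z] turns bounds by [qZ] into bounds by [qY]. *)
  exact: (bounded_operator_comp qnZ R_bounded idYZ).
have -> : T \o R = (fun y => y + S y) by apply/funext => y; exact: TR.
apply: (bounded_operatorD linY qnY); first exact: bounded_operator_id.
exact: (bounded_operator_comp qnZ S_bounded idYZ).
Qed.

Lemma graph_param_in x y : Y y -> G (graph_param x y).
Proof.
move=> Yy; rewrite /G /graph_space /preimage /= linearD.
apply: (linear_manifoldD linY); first exact: complement_bounded.1 x I.
exact: lifting_bounded.1 y Yy.
Qed.

Lemma graph_param_bounded : exists2 K : F, 0 < K & forall x y, Y y ->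
  qG (graph_param x y) <= K * (qX x + qY y).
Proof.
have [C C0 qC] := graph_normD T qnX qnY.
have [C1 C10 PC] := bounded_operator_gt0 qnX complement_bounded.
have [C2 C20 RC] := bounded_operator_gt0 qnY lifting_bounded.
exists (C * (C1 + C2)) => [|x y Yy]; first by rewrite mulr_gt0// addr_gt0.
apply: (le_trans (qC _ _ (complement_bounded.1 x I) (lifting_bounded.1 _ Yy))).
rewrite -mulrA ler_pM2l//; apply: (le_trans (lerD (PC x I) (RC _ Yy))).
have := quasi_norm_ge0 qnX (I : [set: X] x); have := quasi_norm_ge0 qnY Yy.
nra.
Qed.

(** Both claims of the theorem rest on this: [x] and [y] are chosen independently, with no relation
    between [y] and [T x], and [x] need not belong to [G]. *)
Lemma graph_param_approx (e : F) : 0 < e -> exists2 d : F, 0 < d &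
  forall u x y, G u -> Y y -> qX (u - x) < d -> qY (T u - y) < d ->
    qG (u - graph_param x y) < e.
Proof.
move=> e0; have [K K0 KP] := graph_param_bounded.
exists (e / (2 * K)) => [|u x y Gu Yy ux uy].
  by rewrite divr_gt0// mulr_gt0.
(* By linearity in the pair, since [graph_param u (T u) = u]: the terms in [R (T u)] cancel. *)
have -> : u - graph_param x y = graph_param (u - x) (T u - y).
  rewrite /graph_param (linearB T) !(linearB R) opprB [(u - x + _)]addrA subrKA.
  by rewrite !opprD opprK !addrA.
apply: (le_lt_trans (KP _ _ (linear_manifoldB linY Gu Yy))).
have -> : e = K * (e / (2 * K) + e / (2 * K)) by field; rewrite gt_eqF.
by rewrite ltr_pM2l// ltrD.
Qed.

End Parametrization.

Theorem theorem2p2 (F : realType) (X Z : lmodType F[i]) (Y : set Z)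
    (qX : X -> F) (qY qZ : Z -> F)
    (banachX : quasi_banach [set: X] qX)
    (banachY : quasi_banach Y qY)
    (banachZ : quasi_banach [set: Z] qZ)
    (T : {linear X -> Z})
    (T_bounded : bounded_operator [set: X] qX [set: Z] qZ T)
    (YZ : continuous_embedding Y qY [set: Z] qZ)
    (R : {linear Z -> X}) (S : {linear Z -> Z})
    (R_bounded : bounded_operator [set: Z] qZ [set: X] qX R)
    (S_bounded : bounded_operator [set: Z] qZ Y qY S)
    (TR : forall w : Z, T (R w) = w + S w) :
  (separable_space [set: X] qX -> separable_space Y qY ->
   separable_space (graph_space T Y) (graph_norm qX T qY)) /\
  (forall M : set X,
   M `<=` graph_space T Y ->
   (forall u v : X, M u -> M v -> M (u - v)) ->
   dense_in (graph_space T Y) qX M ->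
   dense_in (Y `&` range T) qY (T @` M) ->
   R @` (T @` M) `<=` M ->
   dense_in (graph_space T Y) (graph_norm qX T qY) M).
Proof.
split=> [[DX cDX [_ dX]] [DY cDY [DYY dY]]|M MG MB [_ dM] [_ dTM] RTM].
  (* The points of [DX] may lie outside the graph space; their images under the parametrization lie
     inside it. *)
  exists ((fun p => graph_param T R p.1 p.2) @` (DX `*` DY)).
    apply: (sub_countable (card_image_le _ _)).
    exact: countableX.
  split=> [_ [[x y] [/= _ /DYY Yy] <-]|u Gu e e0].
    exact: (graph_param_in banachX banachY banachZ T_bounded YZ R_bounded
      S_bounded TR).
  have [d d0 dP] := graph_param_approx banachX banachY banachZ T_bounded YZ
    R_bounded S_bounded TR e0.
  have [x Dx ux] := dX u I d d0; have [y Dy uy] := dY _ Gu d d0.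
  exists (graph_param T R x y); first by exists (x, y).
  by apply: dP => //; exact: DYY.
split=> // u Gu e e0.
have [d d0 dP] := graph_param_approx banachX banachY banachZ T_bounded YZ
  R_bounded S_bounded TR e0.
have [m Mm um] := dM u Gu d d0.
(* The element [w] approximates [u] only through [T w], and is in general different from [m]. *)
have [|_ [w Mw <-] uw] := dTM (T u) _ d d0; first by split=> //; exists u.
have RTm v : M v -> M (R (T v)).
  by move=> Mv; apply: RTM; exists (T v) => //; exists v.
exists (graph_param T R m (T w)); last by apply: dP => //; exact: MG.
(* Written with differences only, the approximant is built from [m] and two elements of [R(T(M))],
   all in [M]; closure of [M] under subtraction keeps it there. *)
have -> : graph_param T R m (T w) = m - (R (T m) - R (T w)).
  by rewrite /graph_param opprB addrA addrAC.
by apply: (MB) => //; apply: (MB); exact: RTm.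
Qed.
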